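(* Let $\Sigma$ be a (standard or graded) real structure of a complex algebraic supergroup $G_{\mathbb{C}}$, and let $\Phi$ be the corresponding real structure on the Lie superalgebra $Lie(G_{\mathbb{C}})$, i.e. the one determined by $\Sigma_{A(\epsilon)}(Id+\epsilon M)=Id+\epsilon\,\Phi_A(M)$ for all $A$ in $\mathcal{A}$ and all $M\in Lie(G_{\mathbb{C}})(A)$. Then the real form $(Lie(G_{\mathbb{C}}))^{\Phi}$, defined by $(Lie(G_{\mathbb{C}}))^{\Phi}(A)=\{x\in Lie(G_{\mathbb{C}})(A):\Phi_A(x)=x\}$, is the Lie superalgebra of the real form $G_{\mathbb{C}}^{\Sigma}$; that is, $$Lie(G_{\mathbb{C}}^{\Sigma})=(Lie(G_{\mathbb{C}}))^{\Phi}.$$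
   Context: A superalgebra is a commutative associative (unital) superalgebra $A=A_0\oplus A_1$ over $\mathbb{C}$ (commutative: $xy=(-1)^{|x||y|}yx$ for homogeneous $x,y$). It is called reduced if $A/\mathcal{I}_A^{odd}$ has no nonzero nilpotent elements, where $\mathcal{I}_A^{odd}$ is the ideal generated by $A_1$. A standard conjugation on $A$ is a map $a\mapsto\bar a$, and a graded conjugation a map $a\mapsto\tilde a$; both are additive, parity-preserving and satisfy respectively $\overline{\lambda a}=\bar\lambda\bar a$, $\overline{ab}=\bar a\bar b$, $\bar{\bar a}=a$, and $\widetilde{\lambda a}=\bar\lambda\tilde a$, $\widetilde{ab}=\tilde a\tilde b$, $\tilde{\tilde a}=(-1)^{|a|}a$ (homogeneous $a$), for $\lambda\in\mathbb{C}$. Write $\hat a$ for the conjugate in either case. Fix one of the two types. $\mathcal{A}$ is the category of reduced, finitely generated superalgebras with a conjugation of that type, with superalgebra morphisms commuting with the conjugations; $\mathcal{S}$ is the category of sets. $gl_{m|n}(A)$ is the set of even supermatrices $\begin{pmatrix}P&Q\\R&S\end{pmatrix}$ of size $(m+n)\times(m+n)$, where $P$ ($m\times m$) and $S$ ($n\times n$) have entries in $A_0$ and $Q$ ($m\times n$), $R$ ($n\times m$) have entries in $A_1$; $GL_{m|n}(A)$ is the group of invertible ones (equivalently $P$ and $S$ invertible). A complex algebraic supergroup is a functor $G_{\mathbb{C}}:\mathcal{A}\to\mathcal{S}$ with $G_{\mathbb{C}}(A)=\{x\in GL_{m|n}(A):\mathcal{P}_l(x)=0,\ l=1,\dots,k\}$,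 where the $\mathcal{P}_l$ are polynomials in the matrix entries such that $G_{\mathbb{C}}(A)$ is a group; $G_{\mathbb{C}}(f)$ applies the morphism $f$ to all entries. $A(\epsilon)=(A\oplus\epsilon A)/(\epsilon^2)$ is the superalgebra of dual numbers ($\epsilon$ even), with conjugation $\widehat{x+\epsilon y}=\hat x+\epsilon\hat y$; the functors and natural transformations are also evaluated at $A(\epsilon)$. Let $p:A(\epsilon)\to A$, $p(x+\epsilon y)=x$, and, for $a\in A_0$, $v_a:A(\epsilon)\to A(\epsilon)$, $v_a(x+\epsilon y)=x+\epsilon ay$; $G_{\mathbb{C}}(v_a)$ denotes the application of $v_a$ to all entries. A real structure of $G_{\mathbb{C}}$ is a natural transformation $\Sigma:G_{\mathbb{C}}\to G_{\mathbb{C}}$ such that for all $A$: $\Sigma_A(xy)=\Sigma_A(x)\Sigma_A(y)$ and $\Sigma_A(\Sigma_A(x))=x$ for all $x,y\in G_{\mathbb{C}}(A)$, and $\Sigma_{A(\epsilon)}(G_{\mathbb{C}}(v_a)(z))=G_{\mathbb{C}}(v_{\hat a})(\Sigma_{A(\epsilon)}(z))$ for all $a\in A_0$ and $z\in\ker G_{\mathbb{C}}(p)$. It is standard or graded according to the type of conjugation. The real form associated with $\Sigma$ is the functor $G_{\mathbb{C}}^{\Sigma}:\mathcal{A}\to\mathcal{S}$, $G_{\mathbb{C}}^{\Sigma}(A)=\{x\in G_{\mathbb{C}}(A):\Sigma_A(x)=x\}$ (a group), with $G_{\mathbb{C}}^{\Sigma}(f)$ the restriction of $G_{\mathbb{C}}(f)$.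 For $G=G_{\mathbb{C}}$ or $G=G_{\mathbb{C}}^{\Sigma}$, $Lie(G)$ is the functor $Lie(G)(A)=\ker\bigl(G(p):G(A(\epsilon))\to G(A)\bigr)$, identified with $\{M\in gl_{m|n}(A):Id+\epsilon M\in G(A(\epsilon))\}$, with bracket $[M,N]_A=MN-NM$. $Lie(G_{\mathbb{C}})(A)$ is an $A_0$-module under addition and scalar multiplication of supermatrices. Its grading has as even elements the block-diagonal ones ($Q=R=0$) and as odd elements the block-off-diagonal ones ($P=0$, $S=0$). A real structure on $\mathcal{G}=Lie(G_{\mathbb{C}})$ is a natural transformation $\Phi:\mathcal{G}\to\mathcal{G}$ such that for all $A$, $a,b\in A_0$, $x,y\in\mathcal{G}(A)$: $\Phi_A(ax+by)=\hat a\Phi_A(x)+\hat b\Phi_A(y)$, $\Phi_A(\Phi_A(x))=x$, $\Phi_A([x,y]_A)=[\Phi_A(x),\Phi_A(y)]_A$, and $\Phi_A$ is even (it preserves the even and the odd elements of the grading). For a real structure $\Sigma$ of $G_{\mathbb{C}}$, the formula $\Sigma_{A(\epsilon)}(Id+\epsilon M)=Id+\epsilon\,\Phi_A(M)$ defines a real structure $\Phi$ on $Lie(G_{\mathbb{C}})$. *)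

(* Defs.v *)
From HB Require Import structures.
From mathcomp Require Import all_boot all_order all_algebra.
From mathcomp Require Import boolp classical_sets reals.
From mathcomp Require Import complex.

Set Implicit Arguments.
Unset Strict Implicit.
Unset Printing Implicit Defensive.

Import Order.TTheory GRing.Theory Num.Theory.

Local Open Scope classical_set_scope.
Local Open Scope ring_scope.

(* Superalgebras over K.  [spart false] and [spart true] are the homogeneous   *)
(* parts A_0 and A_1.  MathComp's algType would impose 1 != 0; the structure   *)
(* is built on pzRingType so as not to exclude the zero superalgebra.          *)
HB.mixin Record isSuperAlgebra (K : pzRingType) (A : Type) of GRing.PzRing A := {
  sscale : K -> A -> A;
  sscaleA : forall (c d : K) (x : A), sscale c (sscale d x) = sscale (c * d) x;
  sscale1 : forall x : A, sscale 1 x = x;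
  sscaleDr : forall (c : K) (x y : A),
    sscale c (x + y) = sscale c x + sscale c y;
  sscaleDl : forall (c d : K) (x : A),
    sscale (c + d) x = sscale c x + sscale d x;
  sscaleAl : forall (c : K) (x y : A), sscale c (x * y) = sscale c x * y;
  sscaleAr : forall (c : K) (x y : A), sscale c (x * y) = x * sscale c y;
  spart : bool -> set A;
  spart0 : forall i, spart i 0;
  spartD : forall i (x y : A), spart i x -> spart i y -> spart i (x + y);
  spartZ : forall i (c : K) (x : A), spart i x -> spart i (sscale c x);
  spart_sum : forall x, exists y z, [/\ spart false y, spart true z & x = y + z];
  spart_direct : forall x, spart false x -> spart true x -> x = 0;
  spart1 : spart false 1;
  spartM : forall i j (x y : A),
    spart i x -> spart j y -> spart (i (+) j) (x * y);
  smulC : forall i j (x y : A),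
    spart i x -> spart j y -> x * y = (-1) ^+ (i && j) * (y * x)
}.

#[short(type="superAlgType")]
HB.structure Definition SuperAlgebra (K : pzRingType) :=
  { A of GRing.PzRing A & isSuperAlgebra K A }.

Inductive conj_type := Standard | Graded.

Definition is_graded (t : conj_type) : bool :=
  if t is Graded then true else false.

HB.mixin Record hasSuperConj (K : numClosedFieldType) (t : conj_type) (A : Type)
    of SuperAlgebra K A := {
  hat : A -> A;
  hatD : forall x y, hat (x + y) = hat x + hat y;
  hatZ : forall (c : K) x, hat (sscale c x) = sscale c^* (hat x);
  hatM : forall x y, hat (x * y) = hat x * hat y;
  hat_part : forall i x, spart i x -> spart i (hat x);
  hatK : forall i x, spart i x -> hat (hat x) = (-1) ^+ (is_graded t && i) * x
}.

#[short(type="conjSuperAlgType")]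
HB.structure Definition ConjSuperAlgebra (K : numClosedFieldType) (t : conj_type) :=
  { A of SuperAlgebra K A & hasSuperConj K t A }.

(* Complex polynomials in the indeterminates indexed by [I], as lists of terms *)
(* c * (ordered word).  Every polynomial in supercommuting indeterminates can *)
(* be written this way.                                                        *)
Definition spoly (K I : Type) := seq (K * seq I).

Definition spoly_eval (K : pzRingType) (A : superAlgType K) (I : Type)
    (p : spoly K I) (v : I -> A) : A :=
  \sum_(w <- p) sscale w.1 (\prod_(i <- w.2) v i).

Section Category.
Variables (K : numClosedFieldType) (t : conj_type).

Definition is_ideal (A : superAlgType K) (I : set A) :=
  [/\ I 0, (forall x y, I x -> I y -> I (x + y)),
      (forall a x, I x -> I (a * x)) & (forall a x, I x -> I (x * a))].

Definition odd_ideal (A : superAlgType K) : set A :=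
  [set x | forall I : set A, is_ideal I -> spart true `<=` I -> I x].

(* The quotient of A by its odd ideal has no nonzero nilpotent element. *)
Definition is_reduced (A : superAlgType K) :=
  forall (x : A) (d : nat), odd_ideal (x ^+ d) -> odd_ideal x.

Definition is_fin_gen (A : superAlgType K) :=
  exists (N : nat) (g : 'I_N -> A),
    forall x : A, exists p : spoly K 'I_N, x = spoly_eval p g.

Record csmorphism (A B : conjSuperAlgType K t) := CSMorphism {
  csmor_fun :> {rmorphism A -> B};
  csmorZ : forall (c : K) x, csmor_fun (sscale c x) = sscale c (csmor_fun x);
  csmor_part : forall i x, spart i x -> spart i (csmor_fun x);
  csmor_hat : forall x, csmor_fun (hat x) = hat (csmor_fun x)
}.

Record catA := CatA {
  catA_alg :> conjSuperAlgType K t;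
  catA_reduced : is_reduced catA_alg;
  catA_fin_gen : is_fin_gen catA_alg
}.

End Category.

(* Dual numbers: the pair (x, y) stands for x + epsilon y. *)
Definition dual (A : Type) : Type := (A * A)%type.

Section DualNumbers.
Variables (K : numClosedFieldType) (t : conj_type).

Section DualRing.
Variable A : superAlgType K.

HB.instance Definition _ := GRing.Zmodule.copy (dual A) (A * A)%type.

Definition dual_one : dual A := (1, 0).
Definition dual_mul (u v : dual A) : dual A :=
  (u.1 * v.1, u.1 * v.2 + u.2 * v.1).

Fact dual_mulA : associative dual_mul.
Proof.
move=> [x x'] [y y'] [z z']; rewrite /dual_mul /=.
by congr pair; rewrite ?mulrA // mulrDr mulrDl !mulrA addrA.
Qed.

Fact dual_mul1 : left_id dual_one dual_mul.
Proof. by move=> [x x']; rewrite /dual_mul /= !mul1r mul0r addr0. Qed.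

Fact dual_mulr1 : right_id dual_one dual_mul.
Proof. by move=> [x x']; rewrite /dual_mul /= !mulr1 mulr0 add0r. Qed.

Fact dual_mulDl : left_distributive dual_mul +%R.
Proof.
move=> [x x'] [y y'] [z z']; rewrite /dual_mul /=.
by congr pair; rewrite /= !mulrDl // addrACA.
Qed.

Fact dual_mulDr : right_distributive dual_mul +%R.
Proof.
move=> [x x'] [y y'] [z z']; rewrite /dual_mul /=.
by congr pair; rewrite /= !mulrDr // addrACA.
Qed.

HB.instance Definition _ := GRing.Zmodule_isPzRing.Build (dual A)
  dual_mulA dual_mul1 dual_mulr1 dual_mulDl dual_mulDr.

Lemma dual_addE (u v : dual A) : u + v = (u.1 + v.1, u.2 + v.2) :> dual A.
Proof. exact: erefl. Qed.

Lemma dual_mulE (u v : dual A) :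
  u * v = (u.1 * v.1, u.1 * v.2 + u.2 * v.1) :> dual A.
Proof. exact: erefl. Qed.

Definition dual_part (i : bool) : set (dual A) :=
  [set u | spart i u.1 /\ spart i u.2].

Definition dual_sscale (c : K) (u : dual A) : dual A :=
  (sscale c u.1, sscale c u.2).

Fact dual_sscaleA c d u : dual_sscale c (dual_sscale d u) = dual_sscale (c * d) u.
Proof. by congr pair; apply: sscaleA. Qed.

Fact dual_sscale1 u : dual_sscale 1 u = u.
Proof. by case: u => x y; congr pair; apply: sscale1. Qed.

Fact dual_sscaleDr c u v :
  dual_sscale c (u + v) = dual_sscale c u + dual_sscale c v.
Proof. by congr pair; apply: sscaleDr. Qed.

Fact dual_sscaleDl c d u :
  dual_sscale (c + d) u = dual_sscale c u + dual_sscale d u.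
Proof. by congr pair; apply: sscaleDl. Qed.

Fact dual_sscaleAl c u v : dual_sscale c (u * v) = dual_sscale c u * v.
Proof. by congr pair; rewrite /= ?sscaleDr !sscaleAl. Qed.

Fact dual_sscaleAr c u v : dual_sscale c (u * v) = u * dual_sscale c v.
Proof. by congr pair; rewrite /= ?sscaleDr !sscaleAr. Qed.

Fact dual_part0 i : dual_part i 0.
Proof. by split; apply: spart0. Qed.

Fact dual_partD i u v : dual_part i u -> dual_part i v -> dual_part i (u + v).
Proof. by case=> ? ? [? ?]; split; apply: spartD. Qed.

Fact dual_partZ i c u : dual_part i u -> dual_part i (dual_sscale c u).
Proof. by case=> ? ?; split; apply: spartZ. Qed.

Fact dual_part_sum (u : dual A) :
  exists v w, [/\ dual_part false v, dual_part true w & u = v + w].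
Proof.
case: u => x y.
have [x0 [x1 [hx0 hx1 ->]]] := spart_sum x.
have [y0 [y1 [hy0 hy1 ->]]] := spart_sum y.
by exists (x0, y0), (x1, y1).
Qed.

Fact dual_part_direct (u : dual A) :
  dual_part false u -> dual_part true u -> u = 0.
Proof. by case: u => x y [? ?] [? ?]; congr pair; apply: spart_direct. Qed.

Fact dual_part1 : dual_part false 1.
Proof. by split; [apply: spart1 | apply: spart0]. Qed.

Fact dual_partM i j (u v : dual A) :
  dual_part i u -> dual_part j v -> dual_part (i (+) j) (u * v).
Proof.
case=> ? ? [? ?]; split; first exact: spartM.
by apply: spartD; apply: spartM.
Qed.

Fact dual_mulC i j (u v : dual A) : dual_part i u -> dual_part j v ->
  u * v = (-1) ^+ (i && j) * (v * u).
Proof.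
move=> [hu hu'] [hv hv'].
have h1 := smulC _ _ _ _ hu hv; have h2 := smulC _ _ _ _ hu hv'.
have h3 := smulC _ _ _ _ hu' hv.
rewrite dual_mulE [v * u]dual_mulE h1 h2 h3; case: (i && j).
  by rewrite !expr1 !mulN1r -opprD addrC.
by rewrite !expr0 !mul1r addrC.
Qed.

HB.instance Definition _ := isSuperAlgebra.Build K (dual A)
  dual_sscaleA dual_sscale1 dual_sscaleDr dual_sscaleDl dual_sscaleAl
  dual_sscaleAr dual_part0 dual_partD dual_partZ dual_part_sum
  dual_part_direct dual_part1 dual_partM dual_mulC.

Definition dual_eps : dual A := (0, 1).
Definition dual_inj (x : A) : dual A := (x, 0).
Definition dual_pr (u : dual A) : A := u.1.
Definition dual_scale (a : A) (u : dual A) : dual A := (u.1, a * u.2).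

End DualRing.

Section DualConj.
Variable A : conjSuperAlgType K t.

Definition dual_hat (u : dual A) : dual A := (hat u.1, hat u.2).

Fact dual_hatD u v : dual_hat (u + v) = dual_hat u + dual_hat v.
Proof. by congr pair; apply: hatD. Qed.

Fact dual_hatZ (c : K) u : dual_hat (sscale c u) = sscale c^* (dual_hat u).
Proof. by congr pair; apply: hatZ. Qed.

Fact dual_hatM u v : dual_hat (u * v) = dual_hat u * dual_hat v.
Proof. by congr pair; rewrite /= ?hatD !hatM. Qed.

Fact dual_hat_part i u : spart i u -> spart i (dual_hat u).
Proof. by case=> ? ?; split; apply: hat_part. Qed.

Fact dual_hatK i u : spart i u ->
  dual_hat (dual_hat u) = (-1) ^+ (is_graded t && i) * u.
Proof.
case: u => x y [/= hx hy]; have := hatK _ _ hx; have := hatK _ _ hy.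
rewrite /dual_hat /=; case: (is_graded t && i) => /=;
  by rewrite ?expr1 ?expr0 ?mulN1r ?mul1r => -> ->.
Qed.

HB.instance Definition _ := hasSuperConj.Build K t (dual A)
  dual_hatD dual_hatZ dual_hatM dual_hat_part dual_hatK.

End DualConj.

Section DualMorphism.
Variables (A B : conjSuperAlgType K t) (f : csmorphism A B).

Definition dual_map (u : dual A) : dual B := (f u.1, f u.2).

Fact dual_map_zmod : zmod_morphism dual_map.
Proof. by move=> u v; congr pair; rewrite /= rmorphB. Qed.

Fact dual_map_monoid : monoid_morphism dual_map.
Proof.
split; first by congr pair; rewrite /= ?rmorph1 ?rmorph0.
by move=> u v; congr pair; rewrite /= ?rmorphD !rmorphM.
Qed.

HB.instance Definition _ :=
  GRing.isZmodMorphism.Build (dual A) (dual B) dual_map dual_map_zmod.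
HB.instance Definition _ :=
  GRing.isMonoidMorphism.Build (dual A) (dual B) dual_map dual_map_monoid.

Fact dual_mapZ (c : K) u : dual_map (sscale c u) = sscale c (dual_map u).
Proof. by congr pair; rewrite /= csmorZ. Qed.

Fact dual_map_part i u : spart i u -> spart i (dual_map u).
Proof. by case=> ? ?; split; apply: csmor_part. Qed.

Fact dual_map_hat u : dual_map (hat u) = hat (dual_map u).
Proof. by congr pair; rewrite /= csmor_hat. Qed.

Definition dual_csmor : csmorphism (dual A) (dual B) :=
  @CSMorphism K t (dual A) (dual B) dual_map dual_mapZ dual_map_part dual_map_hat.

End DualMorphism.

(* A(epsilon) is not reduced, so it is not an object of the category A.  The   *)
(* group functors and their natural transformations live on the full           *)
(* subcategory formed by the objects A of the category and the A(epsilon).     *)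
Inductive test_obj := Base of catA K t | Dual of catA K t.

Definition test_alg (T : test_obj) : conjSuperAlgType K t :=
  match T with
  | Base A => A : conjSuperAlgType K t
  | Dual A => dual A : conjSuperAlgType K t
  end.

End DualNumbers.

Coercion test_alg : test_obj >-> ConjSuperAlgebra.type.

Section Supermatrices.
Variables (K : numClosedFieldType) (m n : nat).

Section OneAlgebra.
Variable A : superAlgType K.
Implicit Types x y : 'M[A]_(m + n).

Definition gl : set 'M[A]_(m + n) :=
  [set x | [/\ forall i j, spart false (ulsubmx x i j),
               forall i j, spart true (ursubmx x i j),
               forall i j, spart true (dlsubmx x i j)
             & forall i j, spart false (drsubmx x i j)]].

Definition GL : set 'M[A]_(m + n) :=
  [set x | gl x /\ exists y, [/\ gl y, x *m y = 1%:M & y *m x = 1%:M]].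

Definition is_mxgroup (H : set 'M[A]_(m + n)) :=
  [/\ H 1%:M, (forall x y, H x -> H y -> H (x *m y))
    & (forall x, H x -> exists y, [/\ H y, x *m y = 1%:M & y *m x = 1%:M])].

Definition bracket x y := x *m y - y *m x.

(* Grading of gl_{m|n}(A): these are its even, resp. odd, elements. *)
Definition block_diag x := ursubmx x = 0 /\ dlsubmx x = 0.
Definition block_off_diag x := ulsubmx x = 0 /\ drsubmx x = 0.

(* Id + epsilon M *)
Definition one_eps (M : 'M[A]_(m + n)) : 'M[dual A]_(m + n) :=
  1%:M + dual_eps A *: map_mx (@dual_inj K A) M.

Lemma one_epsE M i j : one_eps M i j = ((1%:M : 'M[A]_(m + n)) i j, M i j).
Proof.
rewrite !mxE dual_mulE /= mul0r mul0r mul1r add0r.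
by case: (i == j); rewrite dual_addE /= ?addr0 ?add0r.
Qed.

End OneAlgebra.

Lemma gl_one_eps (A : superAlgType K) (M : 'M[A]_(m + n)) : gl (one_eps M) -> gl M.
Proof.
have {2}-> : M = map_mx snd (one_eps M).
  by apply/matrixP=> i j; rewrite mxE one_epsE.
case=> h1 h2 h3 h4.
split=> i j; rewrite -?map_ulsubmx -?map_ursubmx -?map_dlsubmx -?map_drsubmx mxE.
- by have [] := h1 i j.
- by have [] := h2 i j.
- by have [] := h3 i j.
- by have [] := h4 i j.
Qed.

Lemma gl_map (t : conj_type) (A B : conjSuperAlgType K t) (f : csmorphism A B)
    (x : 'M[A]_(m + n)) : gl x -> gl (map_mx f x).
Proof.
case=> h1 h2 h3 h4; split=> i j;
  by rewrite -?map_ulsubmx -?map_ursubmx -?map_dlsubmx -?map_drsubmx mxE;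
     apply: csmor_part.
Qed.

Lemma one_eps_map (t : conj_type) (A B : conjSuperAlgType K t)
    (f : csmorphism A B) (M : 'M[A]_(m + n)) :
  map_mx (dual_csmor f) (one_eps M) = one_eps (map_mx f M).
Proof.
apply/matrixP=> i j; rewrite one_epsE mxE one_epsE !mxE.
by rewrite /= /dual_map /= rmorphMn rmorph1.
Qed.

End Supermatrices.

(* Set-valued functors are represented as families of sets of supermatrices    *)
(* stable under entrywise application of morphisms, which is their action on   *)
(* arrows.                                                                     *)
Section Functors.
Variables (K : numClosedFieldType) (t : conj_type) (m n : nat).

Record supergroup := Supergroup {
  sg_pts :> forall T : test_obj K t, set 'M[T]_(m + n);
  sg_GL : forall T, @sg_pts T `<=` @GL K m n T;
  sg_map : forall (T U : test_obj K t) (f : csmorphism T U) x,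
    @sg_pts T x -> @sg_pts U (map_mx f x);
  sg_group : forall T, is_mxgroup (@sg_pts T)
}.

Record gl_functor := GlFunctor {
  glf_pts :> forall A : catA K t, set 'M[A]_(m + n);
  glf_gl : forall A, @glf_pts A `<=` @gl K m n A;
  glf_map : forall (A B : catA K t) (f : csmorphism A B) x,
    @glf_pts A x -> @glf_pts B (map_mx f x)
}.

Arguments sg_pts s T x.
Arguments glf_pts g A x.

Definition matrix_poly := spoly K ('I_(m + n) * 'I_(m + n)).

Definition matrix_poly_eval (A : superAlgType K) (p : matrix_poly)
    (x : 'M[A]_(m + n)) : A := spoly_eval p (fun ij => x ij.1 ij.2).

Definition zero_locus (k : nat) (P : 'I_k -> matrix_poly) (A : superAlgType K) :
    set 'M[A]_(m + n) :=
  [set x | GL x /\ forall l, matrix_poly_eval (P l) x = 0].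

Record algebraic_supergroup := AlgebraicSupergroup {
  asg_num : nat;
  asg_poly : 'I_asg_num -> matrix_poly;
  asg_group : forall T : test_obj K t, is_mxgroup (zero_locus asg_poly (A := T))
}.

Lemma matrix_poly_eval_map (A B : conjSuperAlgType K t) (f : csmorphism A B)
    (p : matrix_poly) (x : 'M[A]_(m + n)) :
  matrix_poly_eval p (map_mx f x) = f (matrix_poly_eval p x).
Proof.
rewrite /matrix_poly_eval /spoly_eval rmorph_sum; apply: eq_bigr => w _.
rewrite csmorZ rmorph_prod; congr sscale; apply: eq_bigr => ij _.
by rewrite mxE.
Qed.

Lemma GL_map (A B : conjSuperAlgType K t) (f : csmorphism A B)
    (x : 'M[A]_(m + n)) : GL x -> GL (map_mx f x).
Proof.
case=> hx [y [hy xy yx]]; split; first exact: gl_map.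
exists (map_mx f y); split; first exact: gl_map.
  by rewrite -map_mxM xy map_mx1.
by rewrite -map_mxM yx map_mx1.
Qed.

Section AlgebraicPoints.
Variable G : algebraic_supergroup.

Let pts (T : test_obj K t) : set 'M[T]_(m + n) := zero_locus (@asg_poly G) (A := T).
Arguments pts : clear implicits.

Fact asg_GL T : pts T `<=` @GL K m n T.
Proof. by move=> x []. Qed.

Fact asg_map (T U : test_obj K t) (f : csmorphism T U) x :
  pts T x -> pts U (map_mx f x).
Proof.
case=> hx h; split; first exact: GL_map.
by move=> l; rewrite matrix_poly_eval_map h rmorph0.
Qed.

Definition asg_supergroup : supergroup :=
  Supergroup asg_GL asg_map (@asg_group G).

End AlgebraicPoints.

Section Lie.
Variable G : supergroup.

Let Lie_pts (A : catA K t) : set 'M[A]_(m + n) :=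
  [set M | gl M /\ G (Dual A) (one_eps M)].
Arguments Lie_pts : clear implicits.

Fact Lie_gl A : Lie_pts A `<=` @gl K m n A.
Proof. by move=> M []. Qed.

Fact Lie_map (A B : catA K t) (f : csmorphism A B) M :
  Lie_pts A M -> Lie_pts B (map_mx f M).
Proof.
case=> hM h; split; first exact: gl_map.
have := sg_map (T := Dual A) (U := Dual B) (dual_csmor f) h.
by rewrite one_eps_map.
Qed.

Definition Lie : gl_functor := GlFunctor Lie_gl Lie_map.

(* M |-> Id + epsilon M identifies [Lie A] with ker (G(p)). *)
Lemma Lie_kerE (A : catA K t) (z : 'M[dual A]_(m + n)) :
  (G (Dual A) z /\ map_mx (@dual_pr K A) z = 1%:M) <->
  (exists2 M, Lie A M & z = one_eps M).
Proof.
split=> [[hz pz]|[M [hM h] ->]]; last first.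
  by split=> //; apply/matrixP=> i j; rewrite mxE one_epsE.
have Ez : z = one_eps (map_mx snd z).
  apply/matrixP=> i j; rewrite one_epsE -pz !mxE.
  by case: (z i j).
exists (map_mx snd z) => //; split; last by rewrite -Ez.
by apply: gl_one_eps; rewrite -Ez; have [] := sg_GL hz.
Qed.

End Lie.

(* [sigma T] is a function on all matrices; only its restriction to G(T)       *)
(* matters.                                                                    *)
Record real_structure (G : supergroup) := RealStructure {
  sigma :> forall T : test_obj K t, 'M[T]_(m + n) -> 'M[T]_(m + n);
  sigma_pts : forall T x, G T x -> G T (sigma x);
  sigma_natural : forall (T U : test_obj K t) (f : csmorphism T U) x,
    G T x -> sigma (map_mx f x) = map_mx f (sigma x);
  sigmaM : forall T x y,
    G T x -> G T y -> sigma (x *m y) = sigma x *m sigma y;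
  sigmaK : forall T x, G T x -> sigma (sigma x) = x;
  sigma_dual : forall (A : catA K t) (a : A) (z : 'M[dual A]_(m + n)),
    spart false a -> G (Dual A) z -> map_mx (@dual_pr K A) z = 1%:M ->
    @sigma (Dual A) (map_mx (dual_scale a) z) =
      map_mx (dual_scale (hat a)) (@sigma (Dual A) z)
}.

Arguments sigma {G} r T x.

Section RealForm.
Variables (G : supergroup) (Sigma : real_structure G).

Let rf_pts (T : test_obj K t) : set 'M[T]_(m + n) :=
  [set x | G T x /\ Sigma T x = x].
Arguments rf_pts : clear implicits.

Fact real_form_GL T : rf_pts T `<=` @GL K m n T.
Proof. by move=> x [/sg_GL]. Qed.

Fact real_form_map (T U : test_obj K t) (f : csmorphism T U) x :
  rf_pts T x -> rf_pts U (map_mx f x).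
Proof.
case=> hx Ex; split; first exact: sg_map.
by rewrite sigma_natural // Ex.
Qed.

Fact real_form_group T : is_mxgroup (rf_pts T).
Proof.
have [G1 GM GV] := sg_group G T.
have S1 : Sigma T 1%:M = 1%:M.
  have hS := sigma_pts Sigma G1.
  have [y [_ _ yS]] := GV _ hS.
  have E : Sigma T 1%:M *m Sigma T 1%:M = Sigma T 1%:M.
    by rewrite -sigmaM // mulmx1.
  by rewrite -[LHS]mul1mx -[X in X *m _]yS -mulmxA E yS.
split=> [|x y [hx Ex] [hy Ey]|x [hx Ex]].
- by split.
- by split; [exact: GM | rewrite sigmaM // Ex Ey].
have [y [hy xy yx]] := GV x hx; exists y; split=> //; split=> //.
by rewrite -[LHS]mul1mx -yx -mulmxA -{1}Ex -sigmaM // xy S1 mulmx1.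
Qed.

Definition real_form : supergroup :=
  Supergroup real_form_GL real_form_map real_form_group.

End RealForm.

(* As for [sigma], only the restriction of [phi A] to g(A) matters. *)
Record Lie_real_structure (g : gl_functor) := LieRealStructure {
  phi :> forall A : catA K t, 'M[A]_(m + n) -> 'M[A]_(m + n);
  phi_pts : forall A x, g A x -> g A (phi x);
  phi_natural : forall (A B : catA K t) (f : csmorphism A B) x,
    g A x -> phi (map_mx f x) = map_mx f (phi x);
  phi_linear : forall (A : catA K t) (a b : A) x y,
    spart false a -> spart false b -> g A x -> g A y ->
    phi (a *: x + b *: y) = hat a *: phi x + hat b *: phi y;
  phiK : forall A x, g A x -> phi (phi x) = x;
  phi_bracket : forall A x y,
    g A x -> g A y -> phi (bracket x y) = bracket (phi x) (phi y);
  phi_even : forall A x, g A x -> block_diag x -> block_diag (phi x);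
  phi_odd : forall A x, g A x -> block_off_diag x -> block_off_diag (phi x)
}.

Arguments phi {g} l A x.

Section LieRealForm.
Variables (g : gl_functor) (Phi : Lie_real_structure g).

Let lrf_pts (A : catA K t) : set 'M[A]_(m + n) :=
  [set x | g A x /\ Phi A x = x].
Arguments lrf_pts : clear implicits.

Fact Lie_real_form_gl A : lrf_pts A `<=` @gl K m n A.
Proof. by move=> x [/glf_gl]. Qed.

Fact Lie_real_form_map (A B : catA K t) (f : csmorphism A B) x :
  lrf_pts A x -> lrf_pts B (map_mx f x).
Proof.
case=> hx Ex; split; first exact: glf_map.
by rewrite phi_natural // Ex.
Qed.

Definition Lie_real_form : gl_functor :=
  GlFunctor Lie_real_form_gl Lie_real_form_map.

End LieRealForm.

(* Sigma_{A(epsilon)} (Id + epsilon M) = Id + epsilon Phi_A(M) *)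
Definition corresponds (G : supergroup) (Sigma : real_structure G)
    (Phi : Lie_real_structure (Lie G)) :=
  forall (A : catA K t) (M : 'M[A]_(m + n)), Lie G A M ->
    Sigma (Dual A) (one_eps M) = one_eps (Phi A M).

End Functors.

Coercion asg_supergroup : algebraic_supergroup >-> supergroup.

(* Main.v *)
Require Import Defs.
From mathcomp Require Import all_boot all_order all_algebra.
From mathcomp Require Import boolp classical_sets.
From mathcomp Require Import reals complex.

(** A point [M] of [Lie G] over [A] is the same thing as the point
    [one_eps M] of [G] over the dual numbers.  It lies in the Lie functor of the
    real form exactly when [one_eps M] is fixed by [Sigma]; since [Sigma] sends
    [one_eps M] to [one_eps (Phi M)] and [M] can be read off from [one_eps M]
    ([one_eps_inj]), this says exactly that [Phi M = M].  The two functors thus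
    have the same points over every [A].  They act on arrows in the same way,
    by entrywise application of morphisms, so they are equal
    ([gl_functor_ext]). *)

Local Open Scope classical_set_scope.
Local Open Scope ring_scope.

Lemma one_eps_inj (K : numClosedFieldType) (m n : nat) (A : superAlgType K) :
  injective (@one_eps K m n A).
Proof.
move=> M N /matrixP E; apply/matrixP => i j.
by have := E i j; rewrite !one_epsE => -[].
Qed.

(** The remaining fields of a functor are proofs, which are identified by proof
    irrelevance. *)
Lemma gl_functor_ext (K : numClosedFieldType) (t : conj_type) (m n : nat)
    (g h : gl_functor K t m n) :
  (forall A M, glf_pts g (A := A) M <-> glf_pts h (A := A) M) -> g = h.
Proof.
case: g h => [g g_gl g_map] [h h_gl h_map] /= gh.
have Egh : g = h.
  by apply: functional_extensionality_dep => A; apply/predeqP => M.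
case: _ / Egh h_gl h_map {gh} => h_gl h_map.
by rewrite (Prop_irrelevance g_gl h_gl) (Prop_irrelevance g_map h_map).
Qed.

(** The correspondence turns the equation [Phi M = M] into [Sigma]-invariance of
    [one_eps M]; the way back needs the injectivity of [one_eps]. *)
Lemma Lie_real_formP (K : numClosedFieldType) (t : conj_type) (m n : nat)
    (G : supergroup K t m n) (Sigma : real_structure G)
    (Phi : Lie_real_structure (Lie G)) :
  corresponds Sigma Phi ->
  forall (A : Defs.catA K t) (M : 'M[A]_(m + n)),
    glf_pts (Lie (real_form Sigma)) (A := A) M
    <-> glf_pts (Lie_real_form Phi) (A := A) M.
Proof.
move=> SigmaPhi A M; split=> [[glM [GM fixM]] | [[glM GM] fixM]].
  split; first by split.
  by apply: one_eps_inj; rewrite -SigmaPhi.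
by split=> //; split=> //; rewrite SigmaPhi // fixM.
Qed.

Theorem theorem3p2 (R : realType) (t : conj_type) (m n : nat)
    (G : algebraic_supergroup R[i] t m n)
    (Sigma : real_structure G)
    (Phi : Lie_real_structure (Lie G))
    (SigmaPhi : corresponds Sigma Phi) :
  Lie (real_form Sigma) = Lie_real_form Phi.
Proof. by apply: gl_functor_ext; apply: Lie_real_formP. Qed.
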